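(* Let $n,k\ge 1$ be integers and let $P_{n,k}$ denote either $P^{-}_{n,k}$ (linear case) or $P^{\circ}_{n,k}$ (circular case). An array $$p^{(1)}_1 p^{(1)}_2\ldots p^{(1)}_n - p^{(2)}_1 p^{(2)}_2\ldots p^{(2)}_n-\cdots-p^{(k)}_1p^{(k)}_2\ldots p^{(k)}_n$$ is the one-line notation of a chained permutation in $P_{n,k}$ if and only if the following hold for all $1\le\ell\le k$: \begin{enumerate} \item each $p^{(\ell)}_i$ ($1\le i\le n$) is an integer with $0\le p^{(\ell)}_i\le n$; \item if $p^{(\ell)}_i=p^{(\ell)}_j$ with $i\ne j$, then $p^{(\ell)}_i=0$; \item the total number of nonzero entries $p^{(\ell')}_i$ ($1\le i\le n$, $1\le \ell'\le k$) equals $\frac{n(k+1)}{2}$ in the linear case with $k$ odd, and $\left\lfloor\frac{nk}{2}\right\rfloor$ in all other cases; \item for every $1\le i\le n$, if $p^{(\ell-1)}_i\neq 0$ then $p^{(\ell)}_j\neq i$ for all $1\le j\le n$; \end{enumerate} where for $P^{\circ}_{n,k}$ we set $p^{(0)}_i=p^{(k)}_i$, and for $P^{-}_{n,k}$ we set $p^{(0)}_i=0$, for all $1\le i\le n$.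
   Context: The sets $P^{-}_{n,k}$ and $P^{\circ}_{n,k}$ of chained linear and circular permutation matrices (chained permutations) consist of the $k$-tuples $(X^{(1)},\dots,X^{(k)})$ of $n\times n$ matrices with entries in $\{0,1\}$ such that: (a) $\sum_{j=1}^n X^{(\ell-1)}_{i,j}+\sum_{j=1}^n X^{(\ell)}_{j,i}\in\{0,1\}$ for all $1\le i\le n$ and $1\le\ell\le k$, where $X^{(0)}=X^{(k)}$ in the circular case and $X^{(0)}$ is the zero matrix in the linear case; in the linear case one also requires that each row sum of $X^{(k)}$ lies in $\{0,1\}$; (b) the sum of all entries $\sum_{i,j,\ell}X^{(\ell)}_{i,j}$ is maximum among all $k$-tuples satisfying (a). The one-line notation of a chained permutation $(X^{(1)},\dots,X^{(k)})$ is the array of numbers $p^{(\ell)}_i$ ($1\le i\le n$, $1\le\ell\le k$), where $p^{(\ell)}_i=j$ if $X^{(\ell)}_{i,j}=1$ (such $j$ is unique), and $p^{(\ell)}_i=0$ if row $i$ of $X^{(\ell)}$ is zero. (In the circular case a trailing dash is appended to the array; this is purely notational.) *)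

(* Defs.v *)
From mathcomp Require Import all_boot all_order all_algebra.

Set Implicit Arguments.
Unset Strict Implicit.
Unset Printing Implicit Defensive.

Import Order.TTheory GRing.Theory Num.Theory.

Local Open Scope nat_scope.

(* All indices are 0-based: [l : 'I_k] stands for the superscript (l+1), and
   [i : 'I_n] for the row or column number i+1.  The entries of a one-line
   notation, on the other hand, are the 1-based column numbers, 0 being
   reserved for zero rows. *)

Variant chain_shape := Linear | Circular.

(* The term of superscript "l - 1" of a family indexed by 1..k.  The term of
   superscript 0 is [z] in the linear case, and the term of superscript k in
   the circular case ([ord_pred] is the cyclic predecessor in 'I_k). *)
Definition prev_term (A : Type) (z : A) (sh : chain_shape) (k : nat)
    (f : 'I_k -> A) (l : 'I_k) : A :=
  match sh with
  | Circular => f (ord_pred l)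
  | Linear => if val l == 0 then z else f (ord_pred l)
  end.

Section ChainedPermutations.
Variables (n k : nat) (sh : chain_shape).
Implicit Type X : k.-tuple 'M[nat]_n.

Definition zero_one X : Prop :=
  forall (l : 'I_k) (i j : 'I_n), tnth X l i j \in pred2 0 1.

Definition chain_condition X : Prop :=
  (forall (l : 'I_k) (i : 'I_n),
     (\sum_(j < n) prev_term (const_mx 0) sh (tnth X) l i j)
       + (\sum_(j < n) tnth X l j i) \in pred2 0 1)
  /\ (sh = Linear ->
      forall (l : 'I_k) (i : 'I_n),
        l.+1 = k -> \sum_(j < n) tnth X l i j \in pred2 0 1).

Definition entry_sum X : nat :=
  \sum_(l < k) \sum_(i < n) \sum_(j < n) tnth X l i j.

Definition chained_perm X : Prop :=
  [/\ zero_one X, chain_condition X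
    & forall Y : k.-tuple 'M[nat]_n,
        zero_one Y -> chain_condition Y -> entry_sum Y <= entry_sum X].

End ChainedPermutations.

(* The array is stored as a matrix whose row l is the block of superscript
   l+1.  The use of [pick] presupposes that each row of each matrix has at most
   one entry 1, as is the case in a chained permutation. *)
Definition one_line (n k : nat) (X : k.-tuple 'M[nat]_n) : 'M[int]_(k, n) :=
  \matrix_(l < k, i < n)
    (if [pick j | tnth X l i j == 1] is Some j then Posz j.+1 else Posz 0).

(* For odd k the division of n * (k + 1) by 2 is exact. *)
Definition nonzero_count (n k : nat) (sh : chain_shape) : nat :=
  match sh with
  | Linear => if odd k then (n * k.+1) %/ 2 else (n * k) %/ 2
  | Circular => (n * k) %/ 2
  end.

(* Main.v *)
Require Import Defs.
From mathcomp Require Import all_boot all_order all_algebra zify.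

(** The statement has two halves: a dictionary between matrix tuples and
    arrays, and the value of the maximum in the definition of a chained
    permutation.

    Dictionary.  [chain_condition] bounds every row sum by 1: the sum of row i of
    X^(l) occurs in the condition for (l+1, i), and for the last matrix of the
    linear case this is its second clause.  So a feasible tuple consists
    of 0/1 matrices with at most one 1 per row, and is recovered from its
    one-line notation by [perms_of] ([one_lineK], [perms_ofK]).  Under this
    correspondence the sum of row i of X^(l-1) tells whether p^(l-1)_i is
    nonzero, and the sum of column i of X^(l) counts the j with p^(l)_j = i.
    That the two add up to at most 1 says that the values of p^(l) are
    distinct, apart from zeros, and that i is not among them when p^(l-1)_i is
    nonzero ([chain_condition_perms_of]).  The total of all entries becomes
    the number of nonzero entries of the array ([entry_sum_perms_of]).

    Maximum.  Let r_l be the sum of the entries of X^(l).  Adding the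
    chain condition over i gives r_(l-1) + r_l <= n.  In the circular case, adding this over l
    counts every r_l twice, so the total is at most nk/2.  In the linear case
    the matrices are grouped in consecutive pairs, one of them staying alone,
    with r_l <= n, when k is odd ([entry_sum_le]).  The bound is attained by
    matrices with ones on a shifted diagonal, j = i + s_l: the shifts only
    have to satisfy s_(l-1) + s_l >= n, and two alternating values of s_l
    suffice in all cases ([nonzero_count_attained]). *)

Set Implicit Arguments.
Unset Strict Implicit.
Unset Printing Implicit Defensive.

Local Open Scope nat_scope.

(** * Sums of natural numbers *)

Lemma mem_pred2_01 (x : nat) : (x \in pred2 0 1) = (x <= 1).
Proof. by case: x => [|[|x]]. Qed.

Lemma sum_bool_le1P (I : finType) (b : pred I) :
  reflect (forall i j, b i -> b j -> i = j) (\sum_i b i <= 1).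
Proof.
have -> : \sum_i b i = #|b|.
  rewrite -sum1_card [RHS]big_mkcond; apply: eq_bigr => i _.
  by rewrite unfold_in; case: (b i).
by apply: (iffP card_le1_eqP) => H i j bi bj; apply: H.
Qed.

Lemma leq_sum_ord m c (F : 'I_m -> nat) :
  (forall i, F i <= c) -> \sum_(i < m) F i <= m * c.
Proof.
move=> Fc; rewrite -[X in X * c]card_ord -sum_nat_const.
by apply: leq_sum => i _.
Qed.

(** Pair the terms from the end: each pair contributes at most [n], and the
    first hypothesis is needed for the term that remains when [k] is odd. *)
Lemma leq_sum_alternating (k n : nat) (r : nat -> nat) :
    (forall l, l < k -> r l <= n) ->
    (forall l, l.+1 < k -> r l + r l.+1 <= n) ->
  \sum_(0 <= l < k) r l <= n * uphalf k.
Proof.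
have [m] := ubnP k; elim: m k => // m IH [|[|k]] ltkm rn rrn.
- by rewrite big_geq.
- by rewrite big_nat1 muln1 rn.
rewrite !big_nat_recr //= -addnA mulnS addnC.
apply: leq_add; first exact: rrn.
by apply: IH => [|l lk|l lk]; [lia | apply: rn; lia | apply: rrn; lia].
Qed.

Lemma sum_alternating (k a b : nat) :
  \sum_(0 <= l < k) (if odd l then b else a) = uphalf k * a + k./2 * b.
Proof.
elim: k => [|k IH]; first by rewrite big_geq.
by rewrite big_nat_recr //= IH uphalf_half; case: (odd k) => /=; nia.
Qed.

(** * Upper bound on the sum of the entries *)

Section Feasible.
Variables (n k : nat) (sh : chain_shape).
Implicit Types (X : k.-tuple 'M[nat]_n) (p : 'M[int]_(k, n)).

Definition row_sum X (l : 'I_k) (i : 'I_n) := \sum_(j < n) tnth X l i j.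
Definition block_sum X (l : 'I_k) := \sum_(i < n) row_sum X l i.

Lemma prev_term_row_sum X l i :
  \sum_(j < n) prev_term (const_mx 0) sh (tnth X) l i j
    = prev_term 0 sh (fun m => row_sum X m i) l.
Proof.
rewrite /prev_term; case: sh => //; case: ifP => // _.
by rewrite big1 // => j _; rewrite mxE.
Qed.

(** Row [i] of block [l] enters the condition of the next block, except in the
    last block of the linear case, which has a condition of its own. *)
Lemma row_sum_le1 X : chain_condition sh X -> forall l i, row_sum X l i <= 1.
Proof.
case=> chainX lastX l i.
have [/andP[lin /eqP lastl]|] :=
    boolP ((if sh is Linear then true else false) && (l.+1 == k)).
  by rewrite -mem_pred2_01 lastX //; case: sh lin.
move=> notlast; have := chainX (ordS l) i.
rewrite mem_pred2_01 prev_term_row_sum => /(leq_trans (leq_addr _ _)).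
rewrite /prev_term; case: sh notlast => [/= notlast|_]; last by rewrite ordSK.
have lk : l.+1 < k by rewrite ltn_neqAle notlast ltn_ord.
by rewrite ordSK /= modn_small.
Qed.

Lemma block_sum_le X : chain_condition sh X -> forall l, block_sum X l <= n.
Proof.
move=> chainX l; rewrite -[leqRHS]muln1; apply: leq_sum_ord => i.
exact: row_sum_le1.
Qed.

(** The rows of one block and the columns of the next compete for the same [n]
    indices. *)
Lemma block_sum_adjacent X : chain_condition sh X ->
  forall l : 'I_k, (sh = Linear -> 0 < l) ->
  block_sum X (ord_pred l) + block_sum X l <= n.
Proof.
move=> [chainX _] l lpos; rewrite {2}/block_sum exchange_big -big_split /=.
rewrite -[leqRHS]muln1; apply: leq_sum_ord => i.
have := chainX l i; rewrite mem_pred2_01 prev_term_row_sum /prev_term.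
by case: sh lpos => // /(_ erefl); rewrite lt0n => /negPf ->.
Qed.

Lemma entry_sum_le X :
  chain_condition sh X -> entry_sum X <= nonzero_count n k sh.
Proof.
move=> chainX; rewrite -[entry_sum X]/(\sum_(l : 'I_k) block_sum X l).
have [shE|shE] : sh = Circular \/ sh = Linear by case: sh; [right | left].
  (* Twice the total is the cyclic sum of the pairs of neighbouring blocks. *)
  rewrite shE /nonzero_count leq_divRL // mulnC mul2n -addnn.
  rewrite [X in X + _](reindex_inj (@ord_pred_inj k)) -big_split /=.
  rewrite mulnC; apply: leq_sum_ord => l.
  by apply: block_sum_adjacent => //; rewrite shE.
pose r l := oapp (block_sum X) 0 (insub l).
have rE (l : 'I_k) : r l = block_sum X l by rewrite /r valK.
have -> : \sum_(l < k) block_sum X l = \sum_(0 <= l < k) r l.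
  by rewrite big_mkord; apply: eq_bigr => l _; rewrite rE.
have : \sum_(0 <= l < k) r l <= n * uphalf k.
  apply: leq_sum_alternating => l lk.
    by rewrite (rE (Ordinal lk)); apply: block_sum_le.
  have := block_sum_adjacent chainX (l := Ordinal lk) (fun _ => isT).
  by rewrite -!rE /= modnDr modn_small // ltnW.
rewrite shE uphalf_half /=; have := odd_double_half k; case: (odd k) => /=; nia.
Qed.

(** * Arrays as tuples of matrices *)

Definition perms_of p : k.-tuple 'M[nat]_n :=
  [tuple (\matrix_(i < n, j < n) nat_of_bool (p l i == Posz j.+1))%R | l < k].

Lemma perms_ofE p l i j : tnth (perms_of p) l i j = (p l i == Posz j.+1).
Proof. by rewrite tnth_mktuple mxE. Qed.

Definition bounded p := forall l i, (0 <= p l i <= Posz n)%R.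

Lemma bounded_case p l i : bounded p ->
  p l i = Posz 0 \/ exists j : 'I_n, p l i = Posz j.+1.
Proof.
move=> /(_ l i); case: (p l i) => // -[_|m /= mn]; [by left | right].
by exists (Ordinal (mn : m < n)).
Qed.

Lemma one_line_bounded X : bounded (one_line X).
Proof. by move=> l i; rewrite mxE; case: pickP => [j _|_] //=; apply: ltn_ord. Qed.

Lemma perms_ofK p : bounded p -> one_line (perms_of p) = p.
Proof.
move=> bp; apply/matrixP => l i; rewrite mxE.
case: pickP => [j|none]; first by rewrite perms_ofE eqb1 => /eqP.
case: (bounded_case l i bp) => [//|[j pE]].
by have := none j; rewrite perms_ofE pE eqxx.
Qed.

(** The one-line notation keeps a single 1 of each row, so nothing is lost
    because the chain condition leaves no room for a second one. *)
Lemma one_lineK X :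
  zero_one X -> chain_condition sh X -> perms_of (one_line X) = X.
Proof.
move=> zoX chainX; apply: eq_from_tnth => l; apply/matrixP => i j.
have XE j' : tnth X l i j' = (tnth X l i j' == 1).
  by have := zoX l i j'; rewrite mem_pred2_01; case: (tnth X l i j') => [|[]].
have /sum_bool_le1P row1 : \sum_j' (tnth X l i j' == 1) <= 1.
  by rewrite -(eq_bigr _ (fun j' _ => XE j')); apply: row_sum_le1.
rewrite perms_ofE XE mxE; congr nat_of_bool.
case: pickP => [j' Xj'|none]; last by rewrite none.
apply/eqP/idP => [[] /val_inj <- //|Xj]; by rewrite (row1 _ _ Xj Xj').
Qed.

Lemma zero_one_perms_of p : zero_one (perms_of p).
Proof. by move=> l i j; rewrite perms_ofE mem_pred2_01 leq_b1. Qed.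

Lemma row_sum_perms_of p l i : bounded p -> row_sum (perms_of p) l i = (p l i != 0%R).
Proof.
move=> bp; under [LHS]eq_bigr do rewrite perms_ofE.
case: (bounded_case l i bp) => [|[j]] ->; first by rewrite big1.
rewrite (bigD1 j) //= eqxx big1 // => j' /negPf; rewrite eqz_nat eqSS.
by rewrite eq_sym -val_eqE /= => ->.
Qed.

Lemma entry_sum_perms_of p : bounded p ->
  entry_sum (perms_of p) = #|[set x : 'I_k * 'I_n | p x.1 x.2 != 0%R]|.
Proof.
move=> bp; rewrite -sum1dep_card [RHS]big_mkcond /=.
rewrite -(pair_bigA _ (fun l i => if p l i != 0%R then 1 else 0)) /=.
apply: eq_bigr => l _; apply: eq_bigr => i _; exact: row_sum_perms_of.
Qed.

(** Each instance of the chain condition has the form b + c <= 1, with b telling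
    whether the preceding block uses row [i], and c counting the occurrences
    of the value [i.+1] in block [l].  It splits into c <= 1, which is
    injectivity away from zero, and c = 0 whenever b = 1, which is
    disjointness from the preceding block. *)
Lemma chain_condition_perms_of p : bounded p ->
  chain_condition sh (perms_of p) <->
  (forall l (i j : 'I_n), p l i = p l j -> i <> j -> p l i = 0%R) /\
  (forall l i, prev_term 0%R sh (fun m => p m i) l <> 0%R ->
     forall j, p l j <> Posz i.+1).
Proof.
move=> bp.
have chainE l i :
    (\sum_(j < n) prev_term (const_mx 0) sh (tnth (perms_of p)) l i j
       + (\sum_(j < n) tnth (perms_of p) l j i) \in pred2 0 1) =
    ((prev_term 0%R sh (fun m => p m i) l != 0%R)
       + \sum_j (p l j == Posz i.+1) <= 1).
  rewrite mem_pred2_01 prev_term_row_sum; congr (_ + _ <= 1).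
    rewrite /prev_term; case: sh; last by rewrite row_sum_perms_of.
    by case: ifP; rewrite ?row_sum_perms_of.
  by apply: eq_bigr => j _; rewrite perms_ofE.
split=> [[chain _]|[inj disj]]; split=> l i.
- move=> j pE ij; case: (bounded_case l i bp) => [//|[c pc]]; case: ij.
  have := chain l c; rewrite chainE => /(leq_trans (leq_addl _ _)) /sum_bool_le1P.
  by apply; apply/eqP => //; rewrite -pE.
- move=> /eqP prev j pj; have := chain l i; rewrite chainE prev.
  by rewrite (bigD1 j) //= pj eqxx.
- rewrite chainE; have [prev|/eqP prev] := eqVneq.
    apply/sum_bool_le1P => a b /eqP pa /eqP pb; apply/eqP/negPn/negP => /eqP ab.
    by have := inj l a b; rewrite pa pb => /(_ erefl ab).
  by rewrite big1 // => j _; apply/eqP; rewrite eqb0; apply/eqP/disj.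
- by move=> j _; rewrite mem_pred2_01 -/(row_sum _ _ _) row_sum_perms_of // leq_b1.
Qed.

End Feasible.

(** * Tuples attaining the bound *)

(** The one-line notation of the tuple whose block [l] has its ones at the
    positions [(i, i + s l)].  Its rows [i < n - s l] and its columns
    [j >= s l] are the nonzero ones: the used rows are initial and the used
    columns final, so disjointness is a mere comparison of sizes. *)
Definition shifts (n k : nat) (s : nat -> nat) : 'M[int]_(k, n) :=
  (\matrix_(l < k, i < n) if (i + s l < n)%N then Posz (i + s l).+1%N else Posz 0)%R.

Lemma shifts_bounded n k s : bounded (shifts n k s).
Proof. by move=> l i; rewrite mxE; case: ifP. Qed.

Lemma shifts_chain n k sh (s : nat -> nat) :
    (forall l : 'I_k, (sh = Linear -> 0 < l) -> n <= s (ord_pred l) + s l) ->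
  chain_condition sh (perms_of (shifts n k s)).
Proof.
move=> hs; apply/chain_condition_perms_of; first exact: shifts_bounded.
split=> [l i j|l i prev j].
  by rewrite !mxE; do 2!case: ifP => // _; move=> [] ij []; apply: val_inj => /=; lia.
have lpos : sh = Linear -> 0 < l.
  by move=> shE; move: prev; rewrite shE /= lt0n; case: eqP.
have : shifts n k s (ord_pred l) i <> 0%R.
  by move: prev; rewrite /prev_term; case: (sh) => //; case: ifP.
have := hs l lpos; rewrite !mxE.
by do 2!case: ifP => // ?; move=> ? _ []; lia.
Qed.

Lemma entry_sum_shifts n k s :
  entry_sum (perms_of (shifts n k s)) = \sum_(0 <= l < k) (n - s l).
Proof.
rewrite big_mkord; apply: eq_bigr => l _.
transitivity (\sum_(i < n) (i + s l < n)).
  apply: eq_bigr => i _; rewrite -/(row_sum _ _ _) row_sum_perms_of ?mxE.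
    by case: ifP.
  exact: shifts_bounded.
transitivity (\sum_(0 <= i < n) (i < n - s l)).
  by rewrite big_mkord; apply: eq_bigr => i _; congr nat_of_bool; lia.
rewrite (big_cat_nat (n := n - s l)) ?leq_subr //=.
rewrite [X in _ + X]big_nat [X in _ + X]big1 => [|i /andP[ni _]]; last by rewrite ltnNge ni.
rewrite (eq_big_nat _ _ (F2 := fun=> 1)) => [|i]; last by case/andP => _ ->.
by rewrite sum_nat_const_nat subn0 muln1 addn0.
Qed.

(** Blocks alternate between [h] and [n - h] ones, starting with [h].  Taking
    [h = n] gives identity matrices separated by zero matrices.  This is
    excluded only in the circular case with [k] odd, where the last block and
    the first, both with [h] ones, are neighbours: then [2 * h <= n] is
    required, and [h = n./2] is best possible. *)
Lemma nonzero_count_attained n k sh : exists X : k.-tuple 'M[nat]_n,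
  [/\ zero_one X, chain_condition sh X & entry_sum X = nonzero_count n k sh].
Proof.
pose h := if sh is Circular then if odd k then n./2 else n else n.
have h_le_n : h <= n by rewrite /h; case: (sh) => //; case: ifP => //; lia.
pose s l := if odd l then h else n - h.
exists (perms_of (shifts n k s)); split; first exact: zero_one_perms_of.
  apply: shifts_chain => l lpos.
  have := ltn_ord l; case: (posnP l) => [l0|l0] lk.
    (* In the circular case, block 0 follows block [k.-1]. *)
    move: lpos; rewrite /s /= l0 /= /h; case: (sh) => [/(_ erefl)|_]; first by lia.
    rewrite modn_small; last by lia.
    have -> : odd (0 + k).-1 = ~~ odd k by lia.
    by case: (odd k) => /=; lia.
  have -> : val (ord_pred l) = l.-1.
    by rewrite /= -[in LHS](prednK l0) /= modnDr modn_small //; lia.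
  have -> : s l.-1 = if odd l then n - h else h.
    by rewrite /s (_ : odd l.-1 = ~~ odd l); [case: (odd l) | lia].
  by rewrite /s; case: (odd l); lia.
rewrite entry_sum_shifts (eq_bigr (fun l => if odd l then n - h else h)); last first.
  by move=> l _; rewrite /s; case: (odd l); lia.
rewrite sum_alternating uphalf_half mulnDl -addnA -mulnDr subnKC //.
have nkE : n * k = odd k * n + (k./2 * n).*2.
  by rewrite -[in LHS](odd_double_half k) mulnDr -doubleMr !(mulnC n).
rewrite /nonzero_count mulnS nkE /h; move: (k./2 * n) => t.
by case: (sh); case: (odd k); lia.
Qed.

Local Open Scope ring_scope.

Theorem theorem3p7 (n k : nat) (hn : (1 <= n)%N) (hk : (1 <= k)%N)
    (sh : chain_shape) (p : 'M[int]_(k, n)) :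
  (exists X : k.-tuple 'M[nat]_n, chained_perm sh X /\ p = one_line X)
  <->
  [/\ forall (l : 'I_k) (i : 'I_n), 0 <= p l i <= n%:Z,
      forall (l : 'I_k) (i j : 'I_n), p l i = p l j -> i <> j -> p l i = 0,
      #|[set x : 'I_k * 'I_n | p x.1 x.2 != 0]| = nonzero_count n k sh
    & forall (l : 'I_k) (i : 'I_n),
        prev_term 0 sh (fun m => p m i) l <> 0 ->
        forall j : 'I_n, p l j <> (i.+1)%:Z].
Proof.
split=> [[X [[zoX chainX maxX] pE]]|[bp inj count disj]].
  have bp : bounded p by rewrite pE; apply: one_line_bounded.
  have XE : X = perms_of p by rewrite pE (one_lineK zoX chainX).
  have := chainX; rewrite XE => /(chain_condition_perms_of sh bp)[inj disj].
  split=> //; rewrite -entry_sum_perms_of // -XE.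
  apply/eqP; rewrite eqn_leq entry_sum_le //.
  by have [Y [zoY chainY <-]] := nonzero_count_attained n k sh; apply: maxX.
exists (perms_of p); split; last by rewrite perms_ofK.
split; [exact: zero_one_perms_of | exact/chain_condition_perms_of |].
by move=> Y _ chainY; rewrite entry_sum_perms_of // count entry_sum_le.
Qed.
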